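(* Let $m\ge n\ge2$ be integers with $(m,n)\neq(2,2)$, let $G_{m,n}=\langle x,y \mid x^m=y^n\rangle$, and let $<_D$ be the Dehornoy-like ordering of $G_{m,n}$ defined by the ordered generating set $\mathcal{S}=\{s_1=xyx^{-m+1},\ s_2=x^{m-1}y^{-1}\}$. Let $G^{(2)}=\langle s_2\rangle$ and let $H$ be a normal subgroup of $G_{m,n}$ such that $G^{(2)}\cap H=\{1\}$. Then, with respect to the restriction of $<_D$ to $H$, the group $H$ contains no non-trivial proper convex subgroup.
   Context: Dehornoy-like ordering: $<_D$ is the left ordering of $G_{m,n}$ (total order invariant under left multiplication) whose positive cone $\{g: 1<_D g\}$ is the set of elements represented either by a word on $s_1,s_2^{\pm1}$ containing at least one $s_1$ and no $s_1^{-1}$, or by $s_2^k$ with $k\ge1$. It is known that this set is indeed the positive cone of a left ordering. For a left ordering $<$ of a group $H$, a subgroup $C\le H$ is convex if $c<h<c'$ with $c,c'\in C$ and $h\in H$ implies $h\in C$. *)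

(* Defs.v *)
From HB Require Import structures.
From mathcomp Require Import all_boot.
From mathcomp Require Import boolp classical_sets.

Set Implicit Arguments.
Unset Strict Implicit.
Unset Printing Implicit Defensive.

Local Open Scope quotient_scope.
Local Open Scope classical_set_scope.
Local Open Scope group_scope.

(* Group words on T: the letter (t, true) stands for t and (t, false) for
   its inverse. *)
Definition word (T : Type) := seq (T * bool).

Definition word_inv (T : Type) (w : word T) : word T :=
  rev [seq (l.1, ~~ l.2) | l <- w].

Definition word_eval (T : Type) (G : groupType) (f : T -> G) (w : word T) : G :=
  foldr (fun l g => (if l.2 then f l.1 else (f l.1)^-1) * g) 1 w.

Section Presentation.
Variables (T : choiceType) (R : word T -> word T -> Prop).

(* Equality of words in < T | u = v for all (u, v) with R u v >. *)
Inductive pres_cong : word T -> word T -> Prop :=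
| pres_refl u : pres_cong u u
| pres_sym u v : pres_cong u v -> pres_cong v u
| pres_trans u v w : pres_cong u v -> pres_cong v w -> pres_cong u w
| pres_cat u u' v v' :
    pres_cong u u' -> pres_cong v v' -> pres_cong (u ++ v) (u' ++ v')
| pres_cancel t b : pres_cong [:: (t, b); (t, ~~ b)] [::]
| pres_rel u v : R u v -> pres_cong u v.

Definition pres_eqv (u v : word T) : bool := `[< pres_cong u v >].

Lemma pres_eqv_refl : reflexive pres_eqv.
Proof. by move=> u; apply/asboolP/pres_refl. Qed.

Lemma pres_eqv_sym : symmetric pres_eqv.
Proof. by move=> u v; apply/asboolP/asboolP; apply: pres_sym. Qed.

Lemma pres_eqv_trans : transitive pres_eqv.
Proof.
by move=> v u w /asboolP uv /asboolP vw; apply/asboolP/(pres_trans uv vw).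
Qed.

Canonical pres_equiv_rel :=
  EquivRel pres_eqv pres_eqv_refl pres_eqv_sym pres_eqv_trans.

Definition pres_group := {eq_quot pres_equiv_rel}.

HB.instance Definition _ := Choice.on pres_group.
HB.instance Definition _ := EqQuotient.on pres_group.

Lemma pres_eqP (u v : word T) :
  pres_cong u v <-> \pi_pres_group u = \pi_pres_group v.
Proof.
by split=> [uv|/eqmodP /asboolP //]; apply/eqmodP/asboolP.
Qed.

Lemma pres_cong_repr (u : word T) : pres_cong (repr (\pi_pres_group u)) u.
Proof. by apply/pres_eqP; rewrite reprK. Qed.

Lemma pres_cong_catV (w : word T) : pres_cong (w ++ word_inv w) [::].
Proof.
elim: w => [|[t b] w IHw]; first exact: pres_refl.
have -> : ((t, b) :: w) ++ word_inv ((t, b) :: w)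
    = [:: (t, b)] ++ (w ++ word_inv w) ++ [:: (t, ~~ b)].
  by rewrite /word_inv /= rev_cons -cats1 catA.
apply: pres_trans (pres_cancel t b).
rewrite -[[:: (t, b); _]]/([:: (t, b)] ++ [::] ++ [:: (t, ~~ b)]).
by do 2?[apply: pres_cat => //; try exact: pres_refl].
Qed.

Lemma word_invK : involutive (@word_inv T).
Proof.
move=> w; rewrite /word_inv map_rev revK -map_comp -[RHS]map_id.
by apply: eq_map => -[t b] /=; rewrite negbK.
Qed.

Lemma pres_cong_inv (u v : word T) :
  pres_cong u v -> pres_cong (word_inv u) (word_inv v).
Proof.
move=> uv; apply: (@pres_trans _ (word_inv u ++ (v ++ word_inv v))).
  rewrite -[X in pres_cong X _]cats0.
  apply: pres_cat; [exact: pres_refl | exact/pres_sym/pres_cong_catV].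
rewrite catA -[X in pres_cong _ X]cat0s.
apply: pres_cat; last exact: pres_refl.
apply: (@pres_trans _ (word_inv u ++ u)).
  by apply: pres_cat; [exact: pres_refl | exact: pres_sym].
by rewrite -[X in _ ++ X]word_invK; exact: pres_cong_catV.
Qed.

Definition pres_mul (g h : pres_group) : pres_group :=
  \pi_pres_group (repr g ++ repr h).
Definition pres_one : pres_group := \pi_pres_group [::].
Definition pres_inv (g : pres_group) : pres_group :=
  \pi_pres_group (word_inv (repr g)).

Lemma pres_piM (u v : word T) :
  \pi_pres_group (u ++ v) = pres_mul (\pi_pres_group u) (\pi_pres_group v).
Proof.
by apply/pres_eqP/pres_cat; apply/pres_sym/pres_cong_repr.
Qed.

Lemma pres_piV (u : word T) :
  \pi_pres_group (word_inv u) = pres_inv (\pi_pres_group u).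
Proof. exact/pres_eqP/pres_cong_inv/pres_sym/pres_cong_repr. Qed.

Lemma pres_mulA : associative pres_mul.
Proof.
elim/quotW=> u; elim/quotW=> v; elim/quotW=> w.
by rewrite -[pres_mul (\pi v) _]pres_piM -[pres_mul (\pi u) (\pi v)]pres_piM
           -[LHS]pres_piM -[RHS]pres_piM catA.
Qed.

Lemma pres_mul1g : left_id pres_one pres_mul.
Proof. by elim/quotW=> u; rewrite -[LHS]pres_piM. Qed.

Lemma pres_mulg1 : right_id pres_one pres_mul.
Proof. by elim/quotW=> u; rewrite -[LHS]pres_piM cats0. Qed.

Lemma pres_mulgV : right_inverse pres_one pres_inv pres_mul.
Proof.
elim/quotW=> u; rewrite -[pres_inv _]pres_piV -[LHS]pres_piM.
exact/pres_eqP/pres_cong_catV.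
Qed.

Lemma pres_mulVg : left_inverse pres_one pres_inv pres_mul.
Proof.
elim/quotW=> u; rewrite -[pres_inv _]pres_piV -[LHS]pres_piM; apply/pres_eqP.
by rewrite -[X in _ ++ X]word_invK; exact: pres_cong_catV.
Qed.

HB.instance Definition _ := isGroup.Build pres_group
  pres_mulA pres_mul1g pres_mulg1 pres_mulVg pres_mulgV.

Definition pres_gen (t : T) : pres_group := \pi_pres_group [:: (t, true)].

End Presentation.

Section LeftOrders.
Variable G : groupType.
Implicit Types (H C P : set G) (lt : G -> G -> Prop) (a b g h : G).

Definition subgroup H : Prop := group_closed [in H].

Definition normal_subgroup H : Prop :=
  subgroup H /\ forall g h, H h -> H (h ^ g).

Definition cyclic_subgroup a : set G :=
  [set g | exists k : nat, g = a ^+ k \/ g = a ^- k].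

(* The left-invariant relation with positive cone P. *)
Definition cone_lt P : G -> G -> Prop := fun g h => P (g^-1 * h).

(* C is a convex subgroup of H for the restriction of lt to H. *)
Definition convex_subgroup lt H C : Prop :=
  [/\ subgroup C, C `<=` H &
      forall c h c', C c -> H h -> C c' -> lt c h -> lt h c' -> C h].

(* Words on the two generators a, b are words on bool: true is a, false is b. *)
Definition dehornoy_cone a b : set G :=
  [set g | (exists w : word bool,
              [/\ (true, true) \in w, (true, false) \notin w &
                  g = word_eval (fun i => if i then a else b) w])
           \/ (exists k : nat, (1 <= k)%N /\ g = b ^+ k)].

Definition dehornoy_lt a b : G -> G -> Prop := cone_lt (dehornoy_cone a b).

End LeftOrders.

Section TorusKnotType.
Variables m n : nat.

(* The generator x is true and the generator y is false. *)
Definition Gmn_rel (u v : word bool) : Prop :=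
  u = nseq m (true, true) /\ v = nseq n (false, true).

Definition Gmn : groupType := pres_group Gmn_rel.

Definition Gmn_x : Gmn := pres_gen Gmn_rel true.
Definition Gmn_y : Gmn := pres_gen Gmn_rel false.

Definition Gmn_s1 : Gmn := Gmn_x * Gmn_y * Gmn_x ^- (m - 1)%N.
Definition Gmn_s2 : Gmn := Gmn_x ^+ (m - 1)%N * Gmn_y^-1.

Definition Gmn_ltD : Gmn -> Gmn -> Prop := dehornoy_lt Gmn_s1 Gmn_s2.

End TorusKnotType.

(* Main.v *)
Require Import Defs.
From mathcomp Require Import all_boot.
From mathcomp Require Import boolp classical_sets.

(** Write D = x ^+ m = y ^+ n, which is central, and call an element positive
    when it is a product of s1, s2 and s2^-1 with at least one factor s1.
    Positive elements absorb powers of s2 on both sides. Two facts about them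
    carry the proof.

    Comparability ([nonneg_total]): g or its inverse is a product of s1, s2
    and s2^-1. Since s1 * s2 = x and y * x = s2^-1 * D, an element with normal
    form D^j x^c (y..x..)...(y..x..) y^b, having k blocks yx, lies between
    D^(j+k) and D^(j+k+1), and such an interval lies on one side of 1. So
    every h <> 1 of H is positive or has a positive inverse: the only other
    possibility is a power of s2, and H contains no nontrivial one.

    Amplification ([twist_lt_sandwich]): for every positive q there is a power
    t of s2 with D < q * t * q. It comes from the identity
      s1 * s2 ^+ 3 * s1 = D * y^(n-2) s2^-1 x^(m-2) y^(n-2) s2^-2,
    where D is multiplied by a positive element because m >= 3, the case
    m = n = 2 being excluded. Geometrically, modulo its center the group is the (m, n, oo)
    triangle group acting on the circle at infinity, the order compares the
    translates of the cusp fixed by s2, and powers of this parabolic s2 push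
    any other point as close as wanted to the next lift of the cusp.

    Let C be a nontrivial convex subgroup of H and q a positive element of C.
    The conjugates q' = t q t^-1 and q'' = t^-1 q t are in H because H is
    normal, and at least one of them is in C. Indeed if q' <= q then
    1 < q' <= q and convexity gives q' in C; if q < q' then q'' < q, because
    multiplying by t on either side preserves positivity, and q'' is in C.
    So C contains q * q' = (q t q) t^-1 or q'' * q = t^-1 (q t q), an element
    e > D. Powers of D are cofinal ([cofinal_twist]), hence so are the powers
    of e, and each h in H lies between two powers of e: convexity yields
    C = H. *)

Local Open Scope quotient_scope.
Local Open Scope classical_set_scope.
Local Open Scope group_scope.

Set Implicit Arguments.
Unset Strict Implicit.

(** * Words in two generators without inverse of the first *)

Section PositiveWords.
Variables (G : groupType) (a b : G).
Implicit Types (g h t : G) (w : word bool).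

Let gen (i : bool) : G := if i then a else b.

Definition pos : set G := [set g | exists w : word bool,
  [/\ (true, true) \in w, (true, false) \notin w & g = word_eval gen w]].

Definition nonneg : set G := [set g | exists w : word bool,
  (true, false) \notin w /\ g = word_eval gen w].

(** Multiplication by such an element, on either side, preserves positivity and
    can be undone: powers of b are of this kind. *)
Definition neutral : set G := [set t | nonneg t /\ nonneg t^-1].

Lemma word_eval_cat w1 w2 :
  word_eval gen (w1 ++ w2) = word_eval gen w1 * word_eval gen w2.
Proof. by elim: w1 => [|l w1 IH] /=; rewrite ?mul1g // IH mulgA. Qed.

Lemma pos_nonneg g : pos g -> nonneg g.
Proof. by case=> w [_ ? ?]; exists w. Qed.

Lemma nonneg1 : nonneg 1.
Proof. by exists [::]. Qed.

Lemma nonnegM g h : nonneg g -> nonneg h -> nonneg (g * h).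
Proof.
move=> [u [nu ->]] [v [nv ->]]; exists (u ++ v).
by rewrite mem_cat negb_or nu nv word_eval_cat.
Qed.

Lemma nonnegX g k : nonneg g -> nonneg (g ^+ k).
Proof.
move=> ng; elim: k => [|k IH]; first exact: nonneg1.
by rewrite expgS; apply: nonnegM.
Qed.

Lemma posMl g h : nonneg g -> pos h -> pos (g * h).
Proof.
move=> [u [nu ->]] [v [pv nv ->]]; exists (u ++ v).
by rewrite !mem_cat negb_or nu nv pv orbT word_eval_cat.
Qed.

Lemma posMr g h : pos g -> nonneg h -> pos (g * h).
Proof.
move=> [u [pu nu ->]] [v [nv ->]]; exists (u ++ v).
by rewrite !mem_cat negb_or nu nv pu word_eval_cat.
Qed.

Lemma pos_fst : pos a.
Proof. by exists [:: (true, true)]; split=> //=; rewrite mulg1. Qed.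

Lemma nonneg_snd : nonneg b.
Proof. by exists [:: (false, true)]; split=> //=; rewrite mulg1. Qed.

Lemma nonneg_sndV : nonneg b^-1.
Proof. by exists [:: (false, false)]; split=> //=; rewrite mulg1. Qed.

Lemma cyclic_mul_snd g :
  cyclic_subgroup b g -> cyclic_subgroup b (b * g) /\ cyclic_subgroup b (b^-1 * g).
Proof.
have key k : cyclic_subgroup b (b^-1 * b ^+ k) /\ cyclic_subgroup b (b * b ^- k).
  case: k => [|k].
    by rewrite invg1 !mulg1; split; exists 1%N; [right|left].
  rewrite {1}expgS mulKg expgSr invgM mulVKg.
  by split; exists k; [left|right].
case=> k [] ->; split; have [? ?] := key k => //.
- by exists k.+1; left; rewrite expgS.
- by exists k.+1; right; rewrite expgSr invgM.
Qed.

(** A word without the letter a^-1 either contains a or spells a power of b. *)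
Lemma nonneg_cases g : nonneg g -> pos g \/ cyclic_subgroup b g.
Proof.
case=> w [nw ->]; elim: w nw => [_|[[] e] w IH]; first by right; exists 0; left.
- case: e => //=; rewrite in_cons negb_or /= => nw; left.
  by apply: posMr pos_fst _; exists w.
- rewrite in_cons negb_or /= => nw.
  have nl : nonneg (if e then b else b^-1).
    by case: e; [apply: nonneg_snd | apply: nonneg_sndV].
  have [pw|/cyclic_mul_snd [cw cVw]] := IH nw.
    by left; apply: posMl.
  by right; case: e {nl}.
Qed.

Lemma neutralM t u : neutral t -> neutral u -> neutral (t * u).
Proof.
by move=> [t1 t2] [u1 u2]; split; rewrite ?invgM; apply: nonnegM.
Qed.

Lemma neutralV t : neutral t -> neutral t^-1.
Proof. by case=> t1 t2; split; rewrite ?invgK. Qed.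

Lemma neutral1 : neutral 1.
Proof. by split; rewrite ?invg1; apply: nonneg1. Qed.

Lemma neutral_snd : neutral b.
Proof. by split; [apply: nonneg_snd|apply: nonneg_sndV]. Qed.

(** This and [pos_last] isolate the outer occurrences of a in a positive word,
    where the amplification identity is applied. *)
Lemma pos_first g : pos g ->
  exists t h, [/\ neutral t, nonneg h & g = t * a * h].
Proof.
case=> w [pw nw ->]; elim: w pw nw => [//|[[] e] w IH].
- case: e => // _; rewrite in_cons negb_or /= => nw.
  exists 1, (word_eval gen w); split; first exact: neutral1.
    by exists w.
  by rewrite mul1g.
- rewrite !in_cons negb_or /= => pw nw.
  have [t [h [nt nh ->]]] := IH pw nw.
  exists ((if e then b else b^-1) * t), h; split => //; last by rewrite !mulgA.
  by apply: neutralM nt; case: e; [|apply: neutralV]; apply: neutral_snd.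
Qed.

Lemma pos_last g : pos g ->
  exists h t, [/\ nonneg h, neutral t & g = h * a * t].
Proof.
case=> w [pw nw ->]; elim: w pw nw => [//|l w IH].
rewrite !in_cons negb_or => pw /andP[nl nw] /=.
have nl' : nonneg (if l.2 then gen l.1 else (gen l.1)^-1).
  by exists [:: l]; rewrite /= inE mulg1.
(* Either the last a occurs in w, or it is the head l and w only has letters
   b and b^-1. *)
have [[h [t [nh nt ->]]]|cw] : (exists h t, [/\ nonneg h, neutral t
    & word_eval gen w = h * a * t]) \/ (true, true) = l /\ neutral (word_eval gen w).
- have [inw|ninw] := boolP ((true, true) \in w); first by left; apply: IH.
  right; move: pw; rewrite (negPf ninw) orbF => /eqP <-; split=> //.
  elim: w nw ninw {IH} => [|[[] e] w IH]; first by move=> _ _; exact: neutral1.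
    by case: e; rewrite !in_cons.
  rewrite !in_cons /= => nw ninw; apply: neutralM (IH nw ninw).
  by case: e; [|apply: neutralV]; apply: neutral_snd.
- by exists ((if l.2 then gen l.1 else (gen l.1)^-1) * h), t;
    split=> //; [apply: nonnegM|rewrite !mulgA].
- case: cw => <- nt; exists 1, (word_eval gen w).
  by split; [apply: nonneg1|exact: nt|rewrite mul1g].
Qed.

Lemma pos_ltD g h : pos (g^-1 * h) -> dehornoy_lt a b g h.
Proof. by move=> p; left. Qed.

End PositiveWords.

(** * Relations between x, y and the Dehornoy-like generators *)

Section TorusRelation.
(* The exponents are m.+3 and n.+2; the comments of this section call them M
   and N, so that M >= 3 and N >= 2. *)
Variables (G : groupType) (x y s1 s2 D : G) (m n : nat).
Hypotheses (xD : x ^+ m.+3 = D) (yD : y ^+ n.+2 = D).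
Hypotheses (s1_def : s1 = x * y * x ^- m.+2) (s2_def : s2 = x ^+ m.+2 * y^-1).
Hypothesis gen_xy : forall Q : G -> Prop, Q 1 ->
  (forall g, Q g -> [/\ Q (x * g), Q (x^-1 * g), Q (y * g) & Q (y^-1 * g)]) ->
  forall g, Q g.

Local Notation pos := (pos s1 s2).
Local Notation nonneg := (nonneg s1 s2).
Local Notation neutral := (neutral s1 s2).

Lemma central_twist g : commute D g.
Proof.
have Dx : commute D x by rewrite -xD; apply/commute_sym/commuteX.
have Dy : commute D y by rewrite -yD; apply/commute_sym/commuteX.
apply: gen_xy g => [|g Dg]; first exact: commute1.
by split; apply: commuteM => //; apply: commuteV.
Qed.

Lemma twistX_comm k g : D ^+ k * g = g * D ^+ k.
Proof. exact/commute_sym/commuteX/commute_sym/central_twist. Qed.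

Lemma s1s2 : s1 * s2 = x.
Proof. by rewrite s1_def s2_def mulgA mulgVK mulgK. Qed.

Lemma yx_twist : y * x = s2^-1 * D.
Proof. by rewrite s2_def invgM invgK -xD (expgSr x m.+2) mulgA mulgVK. Qed.

(** Each block yx of a word contributes one power of D, and what remains of the
    block is a product of s1, s2 and s2^-1. *)
Lemma yx_block b a : y ^+ b.+1 * x ^+ a.+1 = D * (y ^+ b * s2^-1 * x ^+ a).
Proof.
rewrite (expgSr y) (expgS x); move: (y ^+ b) (x ^+ a) => Y X.
by rewrite !mulgA -(mulgA Y y) yx_twist -(mulgA D Y) central_twist !mulgA.
Qed.

(** As s2 fixes the cusp, this says that x and y^(N-1) move it to the same
    point. *)
Lemma xs2 : x * s2 = y ^+ n.+1.
Proof. by rewrite s2_def mulgA -expgS xD -yD expgSr mulgK. Qed.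

Lemma pos_x : pos x.
Proof. by rewrite -s1s2; apply: posMr (pos_fst _ _) (nonneg_snd _ _). Qed.

Lemma nonneg_xX k : nonneg (x ^+ k).
Proof. exact/nonnegX/pos_nonneg/pos_x. Qed.

Lemma pos_xX k : pos (x ^+ k.+1).
Proof. by rewrite expgS; apply: posMr pos_x (nonneg_xX _). Qed.

Lemma pos_y : pos y.
Proof.
have -> : y = s2^-1 * x ^+ m.+2 by rewrite s2_def invgM invgK mulgVK.
exact: posMl (nonneg_sndV _ _) (pos_xX _).
Qed.

Lemma nonneg_yX k : nonneg (y ^+ k).
Proof. exact/nonnegX/pos_nonneg/pos_y. Qed.

(** * Comparability *)

(** A left-invariant preorder in which powers of s2 are equivalent to 1, so
    that it compares left cosets of the subgroup generated by s2. *)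
Definition le g h := nonneg (g^-1 * h).

Lemma le_trans h g k : le g h -> le h k -> le g k.
Proof. by move=> gh hk; have := nonnegM gh hk; rewrite mulgA mulgK. Qed.

Lemma le_mull f g h : le g h -> le (f * g) (f * h).
Proof. by rewrite /le invgM -mulgA mulKg. Qed.

Lemma le_mul_nonneg g h : nonneg h -> le g (g * h).
Proof. by rewrite /le mulKg. Qed.

Lemma leX g (h : G) i j : nonneg h -> i <= j -> le (g * h ^+ i) (g * h ^+ j).
Proof.
by move=> nh /subnKC <-; rewrite expgnDr mulgA; apply/le_mul_nonneg/nonnegX.
Qed.

(** [alternating k v]: v is a reduced word with k blocks yx which is trivial or
    starts with y. The exponent b of the final power of y may vanish, while
    those inside a block are shifted by one to be positive. *)
Inductive alternating : nat -> G -> Prop :=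
| alternating_y b : b <= n.+1 -> alternating 0 (y ^+ b)
| alternating_yx b a k v : b <= n -> a <= m.+1 -> alternating k v ->
    alternating k.+1 (y ^+ b.+1 * x ^+ a.+1 * v).

(** Extracting the k factors D of [yx_block] leaves factors y^b, s2^-1 and x^a. *)
Lemma alternating_ge k v : alternating k v -> le (D ^+ k) v.
Proof.
elim=> [b _|b a {}k {}v _ _ _ IH].
  by rewrite /le invg1 mul1g; apply: nonneg_yX.
rewrite yx_block /le expgS invgM -(mulgA D) -mulgA mulKg mulgA.
have -> h : D ^- k * h = h * D ^- k.
  exact/commute_sym/commuteV/commute_sym/twistX_comm.
rewrite -mulgA.
apply: nonnegM IH; apply: nonnegM (nonneg_xX _).
exact: nonnegM (nonneg_yX _) (nonneg_sndV _ _).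
Qed.

Lemma yX_le_x b : b <= n.+1 -> le (y ^+ b) x.
Proof.
move=> bn; have := leX 1 (pos_nonneg pos_y) bn.
rewrite !mul1g => /le_trans; apply; rewrite -xs2 /le invgM mulgVK.
exact: nonneg_sndV.
Qed.

(** Reducedness gives c + 1 <= M, so that x^c * x is at most D. *)
Lemma xX_le c k v : c <= m.+2 -> le v (D ^+ k * x) -> le (x ^+ c * v) (D ^+ k.+1).
Proof.
move=> cm /(le_mull (x ^+ c)) /le_trans; apply.
rewrite mulgA -twistX_comm -mulgA -expgSr (expgSr D).
rewrite -[X in le _ (_ * X)]xD; apply: leX => //; exact: pos_nonneg pos_x.
Qed.

(** Together with [alternating_ge] this locates v up to one power of D. In a
    block, the power of x turns the bound D^k x into D^(k+1), and the power of
    y, being at most y^(N-1), restores the factor x. *)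
Lemma alternating_le k v : alternating k v -> le v (D ^+ k * x).
Proof.
elim=> [b bn|b a {}k {}v bn am _ IH]; first by rewrite mul1g; apply: yX_le_x.
rewrite -mulgA; apply: (@le_trans (y ^+ b.+1 * D ^+ k.+1)).
  by apply: le_mull; apply: xX_le.
by rewrite -twistX_comm; apply: le_mull; apply: yX_le_x.
Qed.

(** The factor D^i stands for a possibly negative power of D on the right. *)
Definition has_normal_form g := exists i j c k v,
  [/\ c <= m.+2, alternating k v & D ^+ i * g = D ^+ j * (x ^+ c * v)].

(** Normal forms are stable under left multiplication by x and by y, where a
    syllable reaching x^M or y^N becomes D. This suffices: x^-1 and y^-1 are
    positive powers of x and y divided by D. *)
Lemma normal_form g : has_normal_form g.
Proof.
have NFx h : has_normal_form h -> has_normal_form (x * h).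
  case=> i [j [c [k [v [cm av e]]]]].
  have e' : D ^+ i * (x * h) = D ^+ j * (x ^+ c.+1 * v).
    rewrite mulgA (twistX_comm i) -(mulgA x) e expgS.
    by rewrite mulgA -(twistX_comm j) !mulgA.
  move: cm; rewrite leq_eqVlt => /orP[/eqP cE|cm]; last by exists i, j, c.+1, k, v.
  exists i, j.+1, 0, k, v; split=> //.
  by rewrite e' cE xD expg0 mul1g (expgSr D) mulgA.
have NFy h : has_normal_form h -> has_normal_form (y * h).
  case=> i [j [c [k [v [cm av e]]]]].
  have e' : D ^+ i * (y * h) = D ^+ j * (y * (x ^+ c * v)).
    by rewrite mulgA (twistX_comm i) -(mulgA y) e mulgA -(twistX_comm j) !mulgA.
  case: c cm e e' => [|c] cm _; last first.
    move=> e'; exists i, j, 0, k.+1, (y ^+ 1 * x ^+ c.+1 * v).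
    by split=> //; [apply: alternating_yx | rewrite e' expg0 expg1 mul1g !mulgA].
  rewrite expg0 mul1g; case: av => [b bn|b a {}k {}v bn am av] e'.
    move: bn; rewrite leq_eqVlt => /orP[/eqP bE|bn].
      exists i, j.+1, 0, 0, (y ^+ 0); split=> //; first exact: alternating_y.
      by rewrite e' bE -expgS yD !expg0 !mulg1 (expgSr D).
    exists i, j, 0, 0, (y ^+ b.+1); split=> //; first exact: alternating_y.
    by rewrite e' expg0 mul1g expgS.
  move: bn; rewrite leq_eqVlt => /orP[/eqP bE|bn].
    exists i, j.+1, a.+1, k, v; split=> //.
    by rewrite e' bE (mulgA y) (mulgA y) -(expgS y) yD !mulgA -(expgSr D).
  exists i, j, 0, k.+1, (y ^+ b.+2 * x ^+ a.+1 * v); split=> //.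
    exact: alternating_yx.
  by rewrite e' expg0 mul1g (expgS y b.+1) !mulgA.
have NFX f k h : (forall h, has_normal_form h -> has_normal_form (f * h)) -> has_normal_form h -> has_normal_form (f ^+ k * h).
  move=> Nf Nh; elim: k => [|k IH]; first by rewrite mul1g.
  by rewrite expgS -mulgA; apply: Nf.
have NFD h : has_normal_form (D * h) -> has_normal_form h.
  case=> i [j [c [k [v [cm av e]]]]]; exists i.+1, j, c, k, v; split=> //.
  by rewrite (expgSr D) -mulgA.
apply: (gen_xy (Q := has_normal_form)) g => [|h Nh].
  exists 0, 0, 0, 0, (y ^+ 0); split=> //; first exact: alternating_y.
  by rewrite !mulg1.
split; [exact: NFx | | exact: NFy |]; apply: NFD.
- by rewrite -xD expgSr mulgA mulgK; apply: NFX.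
- by rewrite -yD expgSr mulgA mulgK; apply: NFX.
Qed.

(** The normal form places D^i g between two consecutive powers of D, and D^i
    itself cannot fall strictly between them. *)
Lemma nonneg_total g : nonneg g \/ nonneg g^-1.
Proof.
have nD : nonneg D by rewrite -xD; apply: nonneg_xX.
have le_twistX i j : i <= j -> le (D ^+ i) (D ^+ j).
  by move=> ij; have := leX 1 nD ij; rewrite !mul1g.
have [i [j [c [k [v [cm av e]]]]]] := normal_form g.
have lo : le (D ^+ (j + k)) (D ^+ i * g).
  rewrite e expgnDr; apply: le_mull.
  apply: (@le_trans (x ^+ c * D ^+ k)).
    by rewrite -twistX_comm; apply/le_mul_nonneg/nonneg_xX.
  exact/le_mull/alternating_ge.
have hi : le (D ^+ i * g) (D ^+ (j + k.+1)).
  by rewrite e expgnDr; apply/le_mull/xX_le => //; apply: alternating_le.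
have [ij|ji] := leqP i (j + k).
- left; have := le_trans (le_twistX _ _ ij) lo.
  by rewrite /le mulKg.
- right; rewrite -addnS in ji; have := le_trans hi (le_twistX _ _ ji).
  by rewrite /le invgM mulgVK.
Qed.

(** * Powers of the central element *)

(** Each letter x^-1 or y^-1 is compensated by one factor D, as x^-1 D and
    y^-1 D are powers of x and y. *)
Lemma cofinal_twist g : exists j, pos (g * D ^+ j).
Proof.
apply: (gen_xy (Q := fun g => exists j, pos (g * D ^+ j))) g => [|g [j pj]].
  by exists 1%N; rewrite mul1g expg1 -xD; apply: pos_xX.
have up f h : f^-1 * D = h -> nonneg h -> exists j, pos (f^-1 * g * D ^+ j).
  move=> fh nh; exists j.+1.
  have -> : f^-1 * g * D ^+ j.+1 = h * (g * D ^+ j).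
    by rewrite -fh expgS -!mulgA (mulgA g) -(central_twist g) -!mulgA.
  exact: posMl.
split.
- by exists j; rewrite -mulgA; apply: posMl => //; apply/pos_nonneg/pos_x.
- by apply: (up x (x ^+ m.+2)) (nonneg_xX _); rewrite -xD expgS mulKg.
- by exists j; rewrite -mulgA; apply: posMl => //; apply/pos_nonneg/pos_y.
- by apply: (up y (y ^+ n.+1)) (nonneg_yX _); rewrite -yD expgS mulKg.
Qed.

(** After the factor D of [yx_block] is removed from y^(N-1) x^(M-1), there
    remains x^(M-2), which is positive as M >= 3. For M = N = 2 the product
    would be D s2^-3. *)
Lemma twist_lt_s1s2s1 : pos (D^-1 * (s1 * s2 ^+ 3 * s1)).
Proof.
have s1E : s1 = x * s2^-1 by rewrite -s1s2 mulgK.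
have s2xE : s2 * x = x ^+ m.+2 * y ^+ n * s2^-1.
  have s2y : s2 * y = x ^+ m.+2 by rewrite s2_def mulgVK.
  have xE : x = y * y ^+ n * s2^-1 by rewrite -expgS -xs2 mulgK.
  by rewrite [X in s2 * X]xE -(mulgA y) (mulgA s2) s2y mulgA.
have -> : D^-1 * (s1 * s2 ^+ 3 * s1)
    = y ^+ n * s2^-1 * x ^+ m.+1 * (y ^+ n * s2^-1 * s2^-1).
  (* The two middle products are y^(N-1) and x^(M-1) y^(N-2) s2^-1, and meet
     in the block y^(N-1) x^(M-1). *)
  have -> : s1 * s2 ^+ 3 * s1 = x * s2 * (s2 * x) * s2^-1.
    by rewrite {2}s1E -s1s2 !expgS expg0 mulg1 !mulgA.
  rewrite xs2 s2xE; move: (y ^+ n) (yx_block n m.+1) => Y E.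
  by rewrite -(mulgA (x ^+ _)) (mulgA (y ^+ _)) E -!mulgA mulKg.
have nV : nonneg s2^-1 by apply: nonneg_sndV.
apply: posMr; last by do 2?[apply: nonnegM => //]; apply: nonneg_yX.
by apply: posMl (pos_xX _); apply: nonnegM nV; apply: nonneg_yX.
Qed.

(** The neutral element t replaces the powers of s2 after the last s1 of the
    first factor q and before the first s1 of the second one by s2^3. *)
Lemma twist_lt_sandwich q : pos q ->
  exists2 t, neutral t & pos (D^-1 * (q * t * q)).
Proof.
move=> pq; have [h [t [nh nt qE]]] := pos_last pq.
have [u [k [nu nk qE']]] := pos_first pq.
have nz : neutral (s2 ^+ 3).
  by rewrite expgS expg2; do !apply: neutralM; apply: neutral_snd.
move: (s2 ^+ 3) nz twist_lt_s1s2s1 => z nz pz.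
exists (t^-1 * z * u^-1).
  by do !apply: neutralM => //; apply: neutralV.
have -> : D^-1 * (q * (t^-1 * z * u^-1) * q) = h * (D^-1 * (s1 * z * s1)) * k.
  rewrite {1}qE qE' !mulgA mulgK mulgVK.
  congr (_ * _ * _ * _ * _).
  exact/commute_sym/commuteV/commute_sym/central_twist.
by apply: posMr => //; apply: posMl.
Qed.

(** * Convex subgroups *)

(** Each membership in C is obtained by exhibiting positive quotients on both
    sides, that is, by explicit words; so the argument works in every group
    generated by x and y with x^M = y^N, in particular in every quotient of
    the torus-knot-type group. *)
Lemma convex_subgroup_full (H C : set G) : normal_subgroup H ->
  cyclic_subgroup s2 `&` H = [set 1] ->
  convex_subgroup (dehornoy_lt s1 s2) H C -> C <> [set 1] -> C = H.
Proof.
move=> [[H1 HF] HJ] Hs2 [[C1 CF] CH convC] Cn1.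
have {}C1 : C 1 by rewrite inE in C1.
have {}CF g h : C g -> C h -> C (g * h^-1).
  by move=> Cg Ch; have := CF g h; rewrite !inE; apply.
have {}HF g h : H g -> H h -> H (g * h^-1).
  by move=> Hg Hh; have := HF g h; rewrite !inE; apply.
have CV g : C g -> C g^-1 by move/(CF _ _ C1); rewrite mul1g.
have CM g h : C g -> C h -> C (g * h).
  by move=> Cg /CV Ch; rewrite -(invgK h); apply: CF.
have CX g k : C g -> C (g ^+ k).
  by move=> Cg; elim: k => [//|k IH]; rewrite expgS; apply: CM.
have HV g : H g -> H g^-1 by move/(HF _ _ (CH _ C1)); rewrite mul1g.
have HM g h : H g -> H h -> H (g * h).
  by move=> Hg /HV Hh; rewrite -(invgK h); apply: HF.
have between c h c' : C c -> C c' -> H h ->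
    pos (c^-1 * h) -> pos (h^-1 * c') -> C h.
  by move=> Cc Cc' Hh /pos_ltD ch /pos_ltD hc'; exact: (convC c h c').
have nonneg_H h : H h -> nonneg h -> h = 1 \/ pos h.
  move=> Hh /nonneg_cases[|ch]; first by right.
  by left; have : (cyclic_subgroup s2 `&` H) h by []; rewrite Hs2.
have H_cases h : H h -> [\/ h = 1, pos h | pos h^-1].
  move=> Hh; have [/(nonneg_H _ Hh)|/(nonneg_H _ (HV _ Hh))] := nonneg_total h.
    by case=> ?; [apply: Or31|apply: Or32].
  case=> [h1|?]; last exact: Or33.
  by apply: Or31; rewrite -(invgK h) h1 invg1.
have [q Cq pq] : exists2 q, C q & pos q.
  apply: contrapT => nq; apply: Cn1; apply/seteqP; split=> [c Cc /=|_ -> //].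
  have [//|pc|pc] := H_cases _ (CH _ Cc); case: nq.
    by exists c.
  by exists c^-1; first exact: CV.
have [t [nt ntV] pqtq] := twist_lt_sandwich pq.
pose q' := t * q * t^-1; pose q'' := t^-1 * q * t.
have Hq' : H q' by have := HJ t^-1 _ (CH _ Cq); rewrite /conjg invgK mulgA.
have Hq'' : H q'' by have := HJ t _ (CH _ Cq); rewrite /conjg mulgA.
have pq' : pos q' by apply: posMr => //; apply: posMl.
have pq'' : pos q'' by apply: posMr => //; apply: posMl.
have [e Ce De] : exists2 e, C e & pos (D^-1 * e).
  have take_q' : C q' -> exists2 e, C e & pos (D^-1 * e).
    move=> Cq'; exists (q * q'); first exact: CM.
    by rewrite /q' !mulgA -!(mulgA _ _ q); apply: posMr => //; rewrite !mulgA in pqtq *.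
  (* Conjugation by t^-1 turns q < q' into q'' < q. *)
  have [qq'|qq'|qq'] := H_cases _ (HM _ _ (HV _ (CH _ Cq)) Hq').
  - by apply: take_q'; rewrite -(mulVKg q q') qq' mulg1.
  - exists (q'' * q).
      apply: CM => //; apply: (between 1 q'' q) => //.
        by rewrite invg1 mul1g.
      have -> : q''^-1 * q = t^-1 * (q^-1 * q') * t.
        by rewrite /q'' /q' !invgM invgK !mulgA mulgVK.
      by apply: posMr => //; apply: posMl.
    have -> : D^-1 * (q'' * q) = t^-1 * (D^-1 * (q * t * q)).
      rewrite /q'' !mulgA; congr (_ * _ * _ * _).
      exact/commute_sym/commuteV/commute_sym/central_twist.
    exact: posMl.
  - apply: take_q'; apply: (between 1 q' q) => //.
      by rewrite invg1 mul1g.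
    by rewrite invgM invgK in qq'.
have twist_le_eX j : nonneg (D ^- j * e ^+ j).
  rewrite -expVgn -expgMn; first exact/nonnegX/pos_nonneg.
  exact/commute_sym/commuteV/commute_sym/central_twist.
apply/seteqP; split=> // h Hh.
have [i pi] := cofinal_twist h; have [j pj] := cofinal_twist h^-1.
apply: (between (e ^- i) h (e ^+ j)) => //.
- exact/CV/CX.
- exact: CX.
- rewrite invgK.
  have -> : e ^+ i * h = D ^- i * e ^+ i * (h * D ^+ i).
    by rewrite -twistX_comm mulgA -(mulgA (D ^- i)) -(twistX_comm i (e ^+ i)) mulKg.
  exact: posMl.
- have -> : h^-1 * e ^+ j = h^-1 * D ^+ j * (D ^- j * e ^+ j).
    by rewrite mulgA mulgK.
  exact: posMr.
Qed.

End TorusRelation.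

(** * The presented group *)

Lemma Gmn_relation (m n : nat) : Gmn_x m n ^+ m = Gmn_y m n ^+ n.
Proof.
have piX i k : (pres_gen (Gmn_rel m n) i : Gmn m n) ^+ k
    = \pi_(pres_group (Gmn_rel m n)) (nseq k (i, true)).
  elim: k => [//|k IH]; rewrite expgS IH.
  by rewrite -[nseq k.+1 _]/([:: (i, true)] ++ nseq k (i, true)) pres_piM.
by rewrite /Gmn_x /Gmn_y !piX; apply/pres_eqP/pres_rel.
Qed.

Lemma Gmn_ind (m n : nat) (Q : Gmn m n -> Prop) : Q 1 ->
  (forall g, Q g -> [/\ Q (Gmn_x m n * g), Q ((Gmn_x m n)^-1 * g),
                       Q (Gmn_y m n * g) & Q ((Gmn_y m n)^-1 * g)]) ->
  forall g, Q g.
Proof.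
move=> Q1 QM; elim/quotW; elim=> [//|[i b] w /QM [Qx QxV Qy QyV]].
rewrite -cat1s pres_piM.
case: b; first by case: i; [exact: Qx | exact: Qy].
have -> : \pi_(pres_group (Gmn_rel m n)) [:: (i, false)]
    = (pres_gen (Gmn_rel m n) i : Gmn m n)^-1.
  by rewrite -[[:: _]]/(word_inv [:: (i, true)]) pres_piV.
by case: i; [exact: QxV | exact: QyV].
Qed.

Unset Implicit Arguments.

Theorem theorem8 (m n : nat) (hnm : (n <= m)%N) (hn : (2 <= n)%N)
    (hmn : (m, n) <> (2, 2)%N) (H : set (Gmn m n)) (hH : normal_subgroup H)
    (hs2 : cyclic_subgroup (Gmn_s2 m n) `&` H = [set 1]) :
  ~ exists C : set (Gmn m n),
      [/\ convex_subgroup (@Gmn_ltD m n) H C, C <> [set 1] & C <> H].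
Proof.
case=> C [convC Cn1 CnH]; apply: CnH.
have hm : (3 <= m)%N.
  rewrite ltn_neqAle (leq_trans hn hnm) andbT; apply/eqP => m2.
  by apply: hmn; congr (_, _); [|apply/eqP; rewrite eqn_leq hn andbT m2].
case: m hnm hmn H hH hs2 C convC Cn1 hm => [|[|[|m]]] // _ _ H hH hs2 C convC Cn1 _.
case: n hn H hH hs2 C convC Cn1 => [|[|n]] // _ H hH hs2 C convC Cn1.
exact: (convex_subgroup_full (Gmn_relation _ _) erefl erefl erefl (@Gmn_ind _ _)).
Qed.
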